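(* As formal power series in $z$ with coefficients in $\mathbb{Q}(a,c,q)$, $$\cfrac{1}{1-b_0z-\cfrac{a_1z}{1-b_1z-\cfrac{a_2z}{1-b_2z-\cdots}}}=\cfrac{1}{1-\cfrac{\lambda_1z}{1-\cfrac{\lambda_2z}{1-\cdots}}},$$ where $$a_n=\frac{(aq^n-1)cq^{n-1}}{(1-cq^{n-1})(1-cq^n)}\ (n\ge1),\qquad b_n=\frac{aq^n}{1-cq^n}\ (n\ge0),$$ $$\lambda_{2n}=\frac{-cq^{2n-1}(1-aq^n)}{(1-cq^{2n-1})(1-cq^{2n})}\ (n\ge1),\qquad \lambda_{2n+1}=\frac{(a-cq^n)q^n}{(1-cq^{2n})(1-cq^{2n+1})}\ (n\ge0).$$
   Context: $a$, $c$ and $q$ are indeterminates ($a$ without index is a parameter, $a_n$ is a sequence). Infinite continued fractions are understood as limits of their finite truncations in the ring of formal power series in $z$. *)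

(* Defs.v *)
(* Formal power series in one variable over a field, as a commutative unit
   algebra, and finite truncations of continued fractions
   (Mathematical Components). *)
From HB Require Import structures.
From mathcomp Require Import all_boot all_order all_algebra.
From mathcomp Require Import fraction boolp mpoly.

Set Implicit Arguments.
Unset Strict Implicit.
Unset Printing Implicit Defensive.

Import GRing.Theory.
Local Open Scope ring_scope.

Record fps (K : fieldType) := Fps { fps_coef : nat -> K }.

Section PowerSeries.
Variable K : fieldType.
Implicit Types F G H : fps K.

HB.instance Definition _ := gen_eqMixin (fps K).
HB.instance Definition _ := gen_choiceMixin (fps K).

Lemma fpsP F G : fps_coef F =1 fps_coef G <-> F = G.
Proof.
split=> [|-> //]; case: F G => [f] [g] /= fg.
by congr Fps; apply/funext.
Qed.

Definition fps_zero : fps K := Fps (fun=> 0).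
Definition fps_opp F : fps K := Fps (fun n => - fps_coef F n).
Definition fps_add F G : fps K := Fps (fun n => fps_coef F n + fps_coef G n).

Fact fps_addA : associative fps_add.
Proof. by move=> F G H; apply/fpsP=> n /=; rewrite addrA. Qed.
Fact fps_addC : commutative fps_add.
Proof. by move=> F G; apply/fpsP=> n /=; rewrite addrC. Qed.
Fact fps_add0 : left_id fps_zero fps_add.
Proof. by move=> F; apply/fpsP=> n /=; rewrite add0r. Qed.
Fact fps_addN : left_inverse fps_zero fps_opp fps_add.
Proof. by move=> F; apply/fpsP=> n /=; rewrite addNr. Qed.

HB.instance Definition _ :=
  GRing.isZmodule.Build (fps K) fps_addA fps_addC fps_add0 fps_addN.

Definition fps_one : fps K := Fps (fun n => (n == 0%N)%:R).
Definition fps_mul F G : fps K :=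
  Fps (fun n => \sum_(j < n.+1) fps_coef F j * fps_coef G (n - j)).

Definition fps_trunc N F : {poly K} := \poly_(i < N.+1) fps_coef F i.

Lemma coef_fps_trunc N F n : (n <= N)%N -> (fps_trunc N F)`_n = fps_coef F n.
Proof. by move=> nN; rewrite coef_poly ltnS nN. Qed.

Lemma coef_fps_mul N F G n :
  (n <= N)%N -> fps_coef (fps_mul F G) n = (fps_trunc N F * fps_trunc N G)`_n.
Proof.
move=> nN; rewrite coefM; apply: eq_bigr => j _.
by rewrite !coef_fps_trunc // (leq_trans _ nN) ?leq_subr // -ltnS.
Qed.

Fact fps_mulA : associative fps_mul.
Proof.
move=> F G H; apply/fpsP=> n.
transitivity ((fps_trunc n F * (fps_trunc n G * fps_trunc n H))`_n).
  rewrite coefM; apply: eq_bigr => j _.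
  by rewrite (@coef_fps_mul n) ?leq_subr // coef_fps_trunc // -ltnS.
rewrite mulrA coefM; apply: eq_bigr => j _.
by rewrite (@coef_fps_mul n) -1?ltnS // coef_fps_trunc // leq_subr.
Qed.
Fact fps_mulC : commutative fps_mul.
Proof.
by move=> F G; apply/fpsP=> n; rewrite !(@coef_fps_mul n) // mulrC.
Qed.
Fact fps_mul1 : left_id fps_one fps_mul.
Proof.
move=> F; apply/fpsP=> n /=; rewrite big_ord_recl /= mul1r subn0.
by rewrite big1 ?addr0 // => j _; rewrite mul0r.
Qed.
Fact fps_mulD : left_distributive fps_mul fps_add.
Proof.
move=> F G H; apply/fpsP=> n /=; rewrite -big_split.
by apply: eq_bigr => j _; rewrite mulrDl.
Qed.
Fact fps_oner_neq0 : fps_one != 0 :> fps K.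
Proof. by apply/eqP=> /fpsP/(_ 0%N)/eqP; rewrite /= oner_eq0. Qed.

HB.instance Definition _ := GRing.Zmodule_isComNzRing.Build (fps K)
  fps_mulA fps_mulC fps_mul1 fps_mulD fps_oner_neq0.

Definition fps_scale (x : K) F : fps K := Fps (fun n => x * fps_coef F n).

Fact fps_scaleA x y F : fps_scale x (fps_scale y F) = fps_scale (x * y) F.
Proof. by apply/fpsP=> n /=; rewrite mulrA. Qed.
Fact fps_scale1 : left_id 1 fps_scale.
Proof. by move=> F; apply/fpsP=> n /=; rewrite mul1r. Qed.
Fact fps_scaleDr : right_distributive fps_scale +%R.
Proof. by move=> x F G; apply/fpsP=> n /=; rewrite mulrDr. Qed.
Fact fps_scaleDl F : {morph fps_scale^~ F : x y / x + y}.
Proof. by move=> x y; apply/fpsP=> n /=; rewrite mulrDl. Qed.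

HB.instance Definition _ := GRing.Zmodule_isLmodule.Build K (fps K)
  fps_scaleA fps_scale1 fps_scaleDr fps_scaleDl.

Fact fps_scaleAl (x : K) F G : x *: (F * G) = (x *: F) * G.
Proof.
apply/fpsP=> n /=; rewrite mulr_sumr.
by apply: eq_bigr => j _; rewrite mulrA.
Qed.

HB.instance Definition _ := GRing.Lmodule_isLalgebra.Build K (fps K) fps_scaleAl.
HB.instance Definition _ := GRing.Lalgebra_isComAlgebra.Build K (fps K).

(* The first n + 1 coefficients of 1 / F, obtained from the recursion
   F_0 G_(n+1) = - \sum_(i <= n) G_i F_(n+1-i). *)
Fixpoint fps_inv_seq F n : seq K :=
  if n is m.+1 then
    let s := fps_inv_seq F m in
    rcons s (- (fps_coef F 0)^-1 * \sum_(i < n) s`_i * fps_coef F (n - i))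
  else [:: (fps_coef F 0)^-1].

Definition fps_unit : pred (fps K) := fun F => fps_coef F 0 != 0.
(* By the convention of unitRingType, a non-unit is its own inverse. *)
Definition fps_inv F : fps K :=
  if fps_unit F then Fps (fun n => (fps_inv_seq F n)`_n) else F.

Lemma size_fps_inv_seq F n : size (fps_inv_seq F n) = n.+1.
Proof. by elim: n => //= n IHn; rewrite size_rcons IHn. Qed.

Lemma nth_fps_inv_seq F n i :
  (i <= n)%N -> (fps_inv_seq F n)`_i = (fps_inv_seq F i)`_i.
Proof.
elim: n => [|n IHn]; first by rewrite leqn0 => /eqP->.
rewrite leq_eqVlt ltnS => /orP[/eqP-> // | le_in].
by rewrite [in LHS]/= nth_rcons size_fps_inv_seq ltnS le_in IHn.
Qed.

Fact fps_mulV : {in fps_unit, left_inverse 1 fps_inv *%R}.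
Proof.
move=> F F_unit; have F0 : fps_coef F 0 != 0 := F_unit.
apply/fpsP; rewrite /fps_inv [fps_unit F]F_unit => -[|n] /=.
  by rewrite big_ord1 mulVf.
rewrite big_ord_recr /= subnn nth_rcons size_fps_inv_seq ltnn eqxx.
rewrite mulrC mulrA mulrN divff // mulN1r.
apply/eqP; rewrite subr_eq0; apply/eqP/eq_bigr => i _.
by rewrite [in RHS]nth_fps_inv_seq // -ltnS.
Qed.
Fact fps_unitPl F G : G * F = 1 -> fps_unit F.
Proof.
move=> /fpsP/(_ 0%N); rewrite /= big_ord1 => GF1.
by apply/eqP=> F0; move/eqP: GF1; rewrite subn0 F0 mulr0 eq_sym oner_eq0.
Qed.
Fact fps_inv_out : {in [predC fps_unit], fps_inv =1 id}.
Proof.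
by move=> F F_nunit; rewrite /fps_inv ifN //; apply: F_nunit.
Qed.

HB.instance Definition _ := GRing.ComNzRing_hasMulInverse.Build (fps K)
  fps_mulV fps_unitPl fps_inv_out.

Definition fpsX : fps K := Fps (fun n => (n == 1%N)%:R).

(* Convergence for the z-adic topology: each coefficient is eventually
   constant. *)
Definition fps_cvg (u : nat -> fps K) F : Prop :=
  forall n, exists N, forall k, (N <= k)%N -> fps_coef (u k) n = fps_coef F n.

Lemma fps_cvg_unique u F G : fps_cvg u F -> fps_cvg u G -> F = G.
Proof.
move=> uF uG; apply/fpsP=> n.
have [[N uFn] [M uGn]] := (uF n, uG n).
by rewrite -(uFn (maxn N M)) ?leq_maxl // uGn // leq_maxr.
Qed.

End PowerSeries.

(* cfrac_trunc u v k n keeps the first n levels of the continued fraction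
   u_k / (v_k - u_(k+1) / (v_(k+1) - u_(k+2) / (v_(k+2) - ...))). *)
Fixpoint cfrac_trunc (R : unitRingType) (u v : nat -> R) (k n : nat) : R :=
  if n is m.+1 then u k / (v k - cfrac_trunc u v k.+1 m) else 0.

(* F is the value of the infinite continued fraction
   u_0 / (v_0 - u_1 / (v_1 - u_2 / (v_2 - ...))). *)
Definition is_cfrac (K : fieldType) (u v : nat -> fps K) (F : fps K) : Prop :=
  fps_cvg (cfrac_trunc u v 0) F.

Definition Qacq : fieldType := {fraction {mpoly rat[3]}}.
Definition var_a : Qacq := tofrac ('X_(inord 0) : {mpoly rat[3]}).
Definition var_c : Qacq := tofrac ('X_(inord 1) : {mpoly rat[3]}).
Definition var_q : Qacq := tofrac ('X_(inord 2) : {mpoly rat[3]}).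

(* Main.v *)
Require Import Defs.
From mathcomp Require Import all_boot all_order all_algebra.
From mathcomp Require Import fraction mpoly ring.

Set Implicit Arguments.
Unset Strict Implicit.
Unset Printing Implicit Defensive.

Import GRing.Theory.
Local Open Scope ring_scope.

(** Both continued fractions expand the same quotient of basic hypergeometric
    series.  Write [Phi(A; C)] for Heine's series
      2phi1(A, 0; C; q, z) = \sum_n (A; q)_n / ((q; q)_n (C; q)_n) z^n.
    Three contiguous relations hold, each checked coefficient by coefficient
    ([heine_step_diag], [heine_step_even], [heine_step_odd]).

    - The first links [Phi(A; C)], [Phi(Aq; Cq)] and [Phi(Aq^2; Cq^2)].
      Iterated from [(a; c)] along [(aq^k; cq^k)], it has the coefficients
      [b_k] and [a_(k+1)] of the left-hand fraction.
    - The other two shift [C] by [q] at every step and [A] at every other step.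
      Iterated along [(a; c), (aq; cq), (aq; cq^2), (aq^2; cq^3), ...], they
      have the coefficients [lambda_k]: this is Heine's continued fraction with
      one numerator parameter equal to 0.

    Both chains begin with [Phi(a; c), Phi(aq; cq)], so both fractions have the
    value [Phi(aq; cq) / Phi(a; c)].  Passing from a three-term recurrence to
    the value of the fraction is [is_cfrac_recurrence]: the quotients of
    consecutive terms satisfy the same recursion as the truncations, and every
    level of the fraction below the first multiplies the error by a series
    divisible by [z]. *)

(** * Congruences modulo powers of the variable *)

Section Congruence.
Variable K : fieldType.
Implicit Types F G H U V : fps K.

Definition fps_eqm n F G : Prop :=
  forall i, (i < n)%N -> fps_coef F i = fps_coef G i.

Lemma fps_unitE F : (F \is a GRing.unit) = (fps_coef F 0 != 0).
Proof. by []. Qed.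

Lemma coef_fpsD F G n : fps_coef (F + G) n = fps_coef F n + fps_coef G n.
Proof. by []. Qed.

Lemma coef_fpsB F G n : fps_coef (F - G) n = fps_coef F n - fps_coef G n.
Proof. by []. Qed.

Lemma coef0M F G : fps_coef (F * G) 0 = fps_coef F 0 * fps_coef G 0.
Proof. by rewrite /= big_ord1. Qed.

Lemma coef0_zM (x : K) F : fps_coef (x *: fpsX K * F) 0 = 0.
Proof. by rewrite coef0M /= mulr0 mul0r. Qed.

Lemma coefS_zM (x : K) F n :
  fps_coef (x *: fpsX K * F) n.+1 = x * fps_coef F n.
Proof.
rewrite -scalerAl /= 2!big_ord_recl /= mul0r add0r mul1r subSS subn0.
by rewrite big1 ?addr0 // => i _; rewrite mul0r.
Qed.

Lemma fps_eqmM n F G U V :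
  fps_eqm n F G -> fps_eqm n U V -> fps_eqm n (F * U) (G * V).
Proof.
move=> FG UV i lt_in /=; apply: eq_bigr => j _.
by rewrite FG ?UV // (leq_ltn_trans _ lt_in) ?leq_subr // -ltnS.
Qed.

Lemma fps_eqmM_small n U F G :
  fps_coef U 0 = 0 -> fps_eqm n F G -> fps_eqm n.+1 (U * F) (U * G).
Proof.
move=> U0 FG [|i] lt_in /=.
  by rewrite !big_ord1 U0 !mul0r.
rewrite big_ord_recl [RHS]big_ord_recl U0 !mul0r.
congr (_ + _); apply: eq_bigr => j _.
by rewrite FG // subSS (leq_ltn_trans (leq_subr _ _)).
Qed.

(** [F^-1 = F^-1 * (G * G^-1)] is congruent to
    [F^-1 * (F * G^-1) = G^-1]. *)
Lemma fps_eqmV n F G :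
  F \is a GRing.unit -> G \is a GRing.unit ->
  fps_eqm n F G -> fps_eqm n F^-1 G^-1.
Proof.
move=> Fu Gu FG i lt_in.
rewrite -[F^-1]mulr1 -(mulrV Gu) -[G^-1 in RHS]mul1r -(mulVr Fu) -mulrA.
by apply: (@fps_eqmM n) lt_in => //; apply: fps_eqmM => // j /FG.
Qed.

End Congruence.

(** * The value of a continued fraction from a three-term recurrence *)

Section Recurrence.
Variable K : fieldType.
Variables u v G : nat -> fps K.
Hypothesis u_small : forall k, fps_coef (u k.+1) 0 = 0.
Hypothesis G_unit : forall k, G k \is a GRing.unit.
Hypothesis G_rec : forall k, v k * G k.+1 = G k + u k.+1 * G k.+2.

Let tail k := u k * G k.+1 / G k.

(** In other words [tail k = u k / (v k - tail k.+1)]: the [tail k] obey the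
    recursion of the truncations, without an end. *)
Lemma cfrac_denominator k : v k - tail k.+1 = G k / G k.+1.
Proof.
rewrite /tail -[v k](mulrK (G_unit k.+1)) G_rec mulrDl.
by rewrite addrK.
Qed.

(** A level with [k > 0] gains one order of accuracy, since [u k] is divisible
    by [z]; the top level [k = 0], whose numerator need not vanish at 0, gains
    none.  This accounts for the summand [0 < k]. *)
Lemma cfrac_trunc_eqm n k :
  fps_eqm ((0 < k) + n)%N (cfrac_trunc u v k n) (tail k).
Proof.
elim: n k => [|n IHn] k.
  case: k => [|k]; first by [].
  by case=> // _; rewrite /tail -mulrA coef0M u_small mul0r.
have tail_denom : tail k = u k / (v k - tail k.+1).
  by rewrite cfrac_denominator invrM ?unitrV ?G_unit // invrK /tail mulrA.
have denomE : fps_eqm n.+1 (v k - cfrac_trunc u v k.+1 n) (v k - tail k.+1).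
  by move=> i lt_in /=; rewrite IHn.
have tail_unit : v k - tail k.+1 \is a GRing.unit.
  by rewrite cfrac_denominator unitrM unitrV !G_unit.
have trunc_unit : v k - cfrac_trunc u v k.+1 n \is a GRing.unit.
  by move: tail_unit; rewrite !fps_unitE denomE.
have invE := fps_eqmV trunc_unit tail_unit denomE.
rewrite tail_denom [cfrac_trunc u v k n.+1]/=.
case: k invE {IHn tail_denom denomE tail_unit trunc_unit} => [|k] invE.
  by apply: fps_eqmM.
exact: fps_eqmM_small.
Qed.

Lemma is_cfrac_recurrence : is_cfrac u v (u 0%N * G 1%N / G 0%N).
Proof.
by move=> n; exists n.+1 => k le_nk; exact: (@cfrac_trunc_eqm k 0%N n le_nk).
Qed.

End Recurrence.

(** * Heine's series and its contiguous relations *)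

Section Heine.
Variables (K : fieldType) (q : K).
Hypothesis q_reg : forall n, 1 - q ^+ n.+1 != 0.

Definition qpoch (x : K) n : K := \prod_(i < n) (1 - x * q ^+ i).

(** The basic hypergeometric series 2phi1(A, 0; C; q, z). *)
Definition heine (A C : K) : fps K :=
  Fps (fun n => qpoch A n / (qpoch q n * qpoch C n)).

(** Together with [q_reg], this is what keeps every denominator of [heine A C]
    and of its contiguous relations away from 0. *)
Definition qregular (C : K) : Prop := forall n, 1 - C * q ^+ n != 0.

Lemma qregularM C k : qregular C -> qregular (C * q ^+ k).
Proof. by move=> C_reg n; rewrite -mulrA -exprD. Qed.

Lemma qregular_neq0 C : qregular C -> 1 - C != 0.
Proof. by move/(_ 0%N); rewrite expr0 mulr1. Qed.

Lemma qpochSr x n : qpoch x n.+1 = qpoch x n * (1 - x * q ^+ n).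
Proof. by rewrite /qpoch big_ord_recr. Qed.

Lemma qpochSl x n : qpoch x n.+1 = (1 - x) * qpoch (x * q) n.
Proof.
rewrite /qpoch big_ord_recl mulr1; congr (_ * _).
by apply: eq_bigr => i _; rewrite lift0 exprS mulrA.
Qed.

Lemma qpoch_neq0 x n : qregular x -> qpoch x n != 0.
Proof. by move=> x_reg; apply/prodf_neq0 => i _; apply: x_reg. Qed.

Lemma qpoch_q_neq0 n : qpoch q n != 0.
Proof. by apply: qpoch_neq0 => i; rewrite -exprS. Qed.

Lemma heine0 A C : fps_coef (heine A C) 0 = 1.
Proof. by rewrite /= /qpoch !big_ord0 mulr1 divr1. Qed.

Lemma heine_unit A C : heine A C \is a GRing.unit.
Proof. by rewrite fps_unitE heine0 oner_eq0. Qed.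

(** This brings the coefficients in a contiguous relation to a common form: up
    to rational factors in [A], [C], [q] and [q ^+ n], they become
    [qpoch (A * q) n / (qpoch q n * qpoch (C * q) n)], and a rational identity
    is left. *)
Lemma qpoch_shift2 C n : 1 - C * q != 0 ->
  qpoch (C * q * q) n = qpoch (C * q) n * (1 - C * q * q ^+ n) / (1 - C * q).
Proof. by move=> Cq1; rewrite -qpochSr qpochSl [RHS]mulrAC divff // mul1r. Qed.

Section Contiguous.
Variables A C : K.
Hypothesis C_reg : qregular C.

Let C0 : 1 - C != 0 := qregular_neq0 C_reg.
Let Cq : 1 - C * q != 0.
Proof. by have := C_reg 1; rewrite expr1. Qed.
Let Cqn n : 1 - C * q * q ^+ n != 0.
Proof. by rewrite -mulrA -exprS. Qed.
Let pochCq n : qpoch (C * q) n != 0.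
Proof. by apply: qpoch_neq0 => i; apply: Cqn. Qed.
Let qqn n : 1 - q * q ^+ n != 0.
Proof. by rewrite -exprS. Qed.

(** Divided by the common form of the coefficients and cleared of denominators,
    the relation says
      (1 - Aqt)(1 - C) + C(1 - Aqt)(1 - qt) - A(1 - qt)(1 - Cqt)
        = (1 - A)(1 - Cqt)   with t = q^n:
    the first two terms add up to (1 - Aqt)(1 - Cqt). *)
Lemma heine_step_diag :
  (1 - A / (1 - C) *: fpsX K) * heine (A * q) (C * q) =
  heine A C + (A * q - 1) * C / ((1 - C) * (1 - C * q)) *: fpsX K
              * heine (A * q * q) (C * q * q).
Proof.
rewrite mulrBl mul1r; apply/fpsP => -[|n].
  by rewrite coef_fpsB coef_fpsD !coef0_zM !heine0 subr0 addr0.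
rewrite coef_fpsB coef_fpsD !coefS_zM /=.
(* The factor [A * q - 1] is absorbed into [qpoch (A * q * q) n]: it may
   vanish, so it cannot be divided out. *)
have absorb (d e : K) :
    (A * q - 1) * C / d * (qpoch (A * q * q) n / e) =
    - (qpoch (A * q) n * (1 - A * q * q ^+ n)) * C / d / e.
  by rewrite -qpochSr qpochSl; ring.
rewrite absorb qpoch_shift2 // (qpochSl A) (qpochSl C) !qpochSr.
have := pochCq n; have := qpoch_q_neq0 n; have := Cqn n; have := qqn n.
move: (q ^+ n) (qpoch q n) (qpoch (C * q) n) (qpoch (A * q) n) => t Q D P.
by move=> *; field; do ?[apply/andP; split].
Qed.

Lemma heine_step_even :
  heine (A * q) (C * q) =
  heine A C + (A - C) / ((1 - C) * (1 - C * q)) *: fpsX K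
              * heine (A * q) (C * q * q).
Proof.
apply/fpsP => -[|n].
  by rewrite coef_fpsD coef0_zM !heine0 addr0.
rewrite coef_fpsD coefS_zM /=.
rewrite qpoch_shift2 // (qpochSl A) (qpochSl C) !qpochSr.
have := pochCq n; have := qpoch_q_neq0 n; have := Cqn n; have := qqn n.
move: (q ^+ n) (qpoch q n) (qpoch (C * q) n) (qpoch (A * q) n) => t Q D P.
by move=> *; field; do ?[apply/andP; split].
Qed.

Lemma heine_step_odd :
  heine A (C * q) =
  heine A C + - C * (1 - A) / ((1 - C) * (1 - C * q)) *: fpsX K
              * heine (A * q) (C * q * q).
Proof.
apply/fpsP => -[|n].
  by rewrite coef_fpsD coef0_zM !heine0 addr0.
rewrite coef_fpsD coefS_zM /=.
rewrite qpoch_shift2 // (qpochSl A) (qpochSl C) !qpochSr.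
have := pochCq n; have := qpoch_q_neq0 n; have := Cqn n; have := qqn n.
move: (q ^+ n) (qpoch q n) (qpoch (C * q) n) (qpoch (A * q) n) => t Q D P.
by move=> *; field; do ?[apply/andP; split].
Qed.

End Contiguous.

(** * The two expansions of the quotient *)

Variables a c : K.
Hypothesis c_reg : qregular c.

Lemma is_cfrac_diag (a_ b_ : nat -> K) :
  (forall n, (1 <= n)%N ->
     a_ n = (a * q ^+ n - 1) * c * q ^+ (n - 1)
            / ((1 - c * q ^+ (n - 1)) * (1 - c * q ^+ n))) ->
  (forall n, b_ n = a * q ^+ n / (1 - c * q ^+ n)) ->
  is_cfrac (fun n => if n == 0%N then 1 else a_ n *: fpsX K)
           (fun n => 1 - b_ n *: fpsX K)
           (heine (a * q) (c * q) / heine a c).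
Proof.
move=> a_E b_E.
pose G k := heine (a * q ^+ k) (c * q ^+ k).
have -> : heine (a * q) (c * q) / heine a c = 1 * G 1%N / G 0%N.
  by rewrite /G mul1r !expr1 !mulr1.
apply: (@is_cfrac_recurrence _ (fun n => if n == 0%N then 1 else _) _ G).
- by move=> k; rewrite /= mulr0.
- by move=> k; apply: heine_unit.
move=> k /=; rewrite b_E a_E // subn1 /= /G !exprSr !mulrA.
rewrite (heine_step_diag _ (qregularM k c_reg)).
by congr (_ + _ *: _ * _); rewrite -!mulrA.
Qed.

(** The parameter pairs climb a staircase, [A] moving only on the steps that
    leave an even index; hence the exponent [uphalf k] of [q] in [G k]. *)
Lemma is_cfrac_staircase (lambda_ : nat -> K) :
  (forall n, (1 <= n)%N ->
     lambda_ (2 * n)%N =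
       - c * q ^+ (2 * n - 1) * (1 - a * q ^+ n)
       / ((1 - c * q ^+ (2 * n - 1)) * (1 - c * q ^+ (2 * n)))) ->
  (forall n,
     lambda_ (2 * n + 1)%N =
       (a - c * q ^+ n) * q ^+ n
       / ((1 - c * q ^+ (2 * n)) * (1 - c * q ^+ (2 * n + 1)))) ->
  is_cfrac (fun n => if n == 0%N then 1 else lambda_ n *: fpsX K) (fun=> 1)
           (heine (a * q) (c * q) / heine a c).
Proof.
move=> even_E odd_E.
pose G k := heine (a * q ^+ uphalf k) (c * q ^+ k).
have -> : heine (a * q) (c * q) / heine a c = 1 * G 1%N / G 0%N.
  by rewrite /G mul1r !expr1 !mulr1.
apply: (@is_cfrac_recurrence _ (fun n => if n == 0%N then 1 else _) _ G).
- by move=> k; rewrite /= mulr0.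
- by move=> k; apply: heine_unit.
move=> k; rewrite mul1r [_ == _]/= -[k]odd_double_half.
move: (k./2) => m; case: (odd k); rewrite ?add1n ?add0n /G.
  have -> : uphalf m.*2.+3 = m.+2 by rewrite /= doubleK.
  rewrite -doubleS -mul2n even_E // mul2n subn1 uphalf_double.
  have -> : uphalf m.*2.+1 = m.+1 by rewrite /= doubleK.
  rewrite doubleS [_.-1]/= (exprSr q m.+1) (exprSr q m.*2.+2).
  rewrite (exprSr q m.*2.+1) !mulrA.
  rewrite (heine_step_odd _ (qregularM m.*2.+1 c_reg)).
  by rewrite !mulNr.
have -> : uphalf m.*2.+1 = m.+1 by rewrite /= doubleK.
have -> : lambda_ m.*2.+1 = lambda_ (2 * m + 1)%N by rewrite mul2n addn1.
rewrite odd_E mul2n addn1 -doubleS !uphalf_double doubleS.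
rewrite (exprSr q m) (exprSr q m.*2.+1) (exprSr q m.*2) !mulrA.
rewrite (heine_step_even _ (qregularM m.*2 c_reg)).
by congr (_ + (_ / _) *: _ * _); rewrite -addnn exprD; ring.
Qed.

End Heine.

(** Evaluation at the origin sends [1 - p] to 1. *)
Lemma tofrac_1B_neq0 (p : {mpoly rat[3]}) :
  p.@[fun=> 0] = 0 -> 1 - tofrac p != 0 :> Qacq.
Proof.
move=> p0; rewrite -tofrac1 -tofracB tofrac_eq0; apply/eqP => p1.
have := congr1 (meval (fun=> 0)) p1.
by rewrite mevalB meval1 p0 meval0 subr0 => /eqP; rewrite oner_eq0.
Qed.

Unset Implicit Arguments.

Theorem theorem5p12 (a_ b_ lambda_ : nat -> Qacq) :
  let a := var_a in let c := var_c in let q := var_q in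
  let z : fps Qacq := fpsX Qacq in
  (forall n : nat, (1 <= n)%N ->
     a_ n = (a * q ^+ n - 1) * c * q ^+ (n - 1)
            / ((1 - c * q ^+ (n - 1)) * (1 - c * q ^+ n))) ->
  (forall n : nat,
     b_ n = a * q ^+ n / (1 - c * q ^+ n)) ->
  (forall n : nat, (1 <= n)%N ->
     lambda_ (2 * n)%N =
       - c * q ^+ (2 * n - 1) * (1 - a * q ^+ n)
       / ((1 - c * q ^+ (2 * n - 1)) * (1 - c * q ^+ (2 * n)))) ->
  (forall n : nat,
     lambda_ (2 * n + 1)%N =
       (a - c * q ^+ n) * q ^+ n
       / ((1 - c * q ^+ (2 * n)) * (1 - c * q ^+ (2 * n + 1)))) ->
  exists F : fps Qacq,
    is_cfrac (fun n => if n == 0%N then 1 else a_ n *: z)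
             (fun n => 1 - b_ n *: z) F
    /\ is_cfrac (fun n => if n == 0%N then 1 else lambda_ n *: z)
                (fun=> 1) F.
Proof.
move=> a c q z a_E b_E even_E odd_E.
have q_reg n : 1 - q ^+ n.+1 != 0.
  rewrite /q /var_q -tofracXn tofrac_1B_neq0 //.
  by rewrite rmorphXn /= mevalXU expr0n.
have c_reg : qregular q c.
  move=> n; rewrite /q /c /var_q /var_c -tofracXn -tofracM tofrac_1B_neq0 //.
  by rewrite mevalM mevalXU mul0r.
exists (heine q (a * q) (c * q) / heine q a c); split.
  exact: is_cfrac_diag.
exact: is_cfrac_staircase.
Qed.
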